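(* Consider the game ''Corner the Queen Bee'' described in the context, and let $(a_n,b_n)$, $n\ge 1$, be its $P$-positions other than $(0,0)$ with $a_n\le b_n$, listed in increasing order of the first coordinate. Then $b_n=2a_n$ for every $n\ge 1$, and every positive integer occurs exactly once among the numbers $a_1,b_1,a_2,b_2,\ldots$.
   Context: Positions are pairs $(x,y)$ of nonnegative integers (squares of an infinite quarter-plane chess board). From $(x,y)$ the Queen Bee may move to: (i) $(x',y)$ with $0\le x'<x$, or $(x,y')$ with $0\le y'<y$; (ii) $(x-s,y-s)$ with $1\le s\le\min(x,y)$ (diagonal move); (iii) bouncing moves: if $x<y$, to $(t,y-x)$ with $0<t<2x$; if $x>y$, to $(x-y,t)$ with $0<t<2y$ (she travels diagonally to the side of the board and then continues perpendicular to that side, as long as the Manhattan distance $x+y$ strictly decreases). Every move strictly decreases $x+y$. Two players alternate moves; the player who moves the Queen to $(0,0)$ wins (normal play). $P$-positions are defined recursively: $(0,0)$ is a $P$-position, and a position is a $P$-position iff it has no move to a $P$-position. The set of $P$-positions is symmetric under $(x,y)\mapsto(y,x)$. *)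

(* Defs.v *)
From mathcomp Require Import all_boot zify.

Set Implicit Arguments.
Unset Strict Implicit.
Unset Printing Implicit Defensive.

Definition position := (nat * nat)%type.

(* In a bounce the Queen reaches (0, y - x), resp. (x - y, 0), diagonally and then
   moves perpendicularly to that side; t < 2 * x, resp. t < 2 * y, says that the
   sum of the coordinates decreases. *)
Inductive bee_move : position -> position -> Prop :=
| LeftMove x y x' : x' < x -> bee_move (x, y) (x', y)
| DownMove x y y' : y' < y -> bee_move (x, y) (x, y')
| DiagonalMove x y s :
    1 <= s <= minn x y -> bee_move (x, y) (x - s, y - s)
| BounceLeftMove x y t :
    x < y -> 0 < t < 2 * x -> bee_move (x, y) (t, y - x)
| BounceDownMove x y t :
    y < x -> 0 < t < 2 * y -> bee_move (x, y) (x - y, t).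

Definition option_of (q p : position) : Prop := bee_move p q.

Lemma bee_move_decr p q : bee_move p q -> q.1 + q.2 < p.1 + p.2.
Proof. by case=> /= *; lia. Qed.

Lemma option_of_wf : well_founded option_of.
Proof.
suff H n p : p.1 + p.2 < n -> Acc option_of p by move=> p; apply: H (ltnSn _).
elim: n p => [|n IHn] p lepn; first by rewrite ltn0 in lepn.
apply: Acc_intro => q /bee_move_decr ltqp; apply: IHn.
exact: leq_trans ltqp lepn.
Qed.

Definition P_position : position -> Prop :=
  Fix option_of_wf (fun _ => Prop)
    (fun p (isP : forall q, option_of q p -> Prop) =>
       forall q (m : option_of q p), ~ isP q m).

Lemma P_positionE p :
  P_position p <-> (forall q, bee_move p q -> ~ P_position q).
Proof.
pose F p (isP : forall q, option_of q p -> Prop) :=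
  forall q (m : option_of q p), ~ isP q m.
have irr : forall q, Acc option_of q -> forall u v : Acc option_of q,
    Fix_F (fun _ => Prop) F u -> Fix_F (fun _ => Prop) F v.
  move=> q; elim=> {}q _ IH [u] [v] /= Hu r m Hr.
  by apply: (Hu r m); apply: IH Hr.
rewrite {1}/P_position /Fix; case: (option_of_wf p) => u /=.
by split=> H q m Hq; apply: (H q m);
  apply: irr Hq; apply: option_of_wf.
Qed.

(* The sequences are indexed by n >= 1; the values at 0 are irrelevant.
   Strictness of the order makes such a listing free of repetitions. *)
Definition lists_P_positions (a b : nat -> nat) : Prop :=
  [/\ forall n, 1 <= n ->
        [/\ P_position (a n, b n), (a n, b n) <> (0, 0) & a n <= b n],
      forall x y, P_position (x, y) -> (x, y) <> (0, 0) -> x <= y ->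
        exists2 n, 1 <= n & (a n, b n) = (x, y)
    & forall m n, 1 <= m -> m < n -> a m < a n].

(* An occurrence of k in a_1, b_1, a_2, b_2, ... is a pair (n, c) with n >= 1,
   where c tells whether the term is b_n or a_n; thus a_n = b_n = k would count
   as two occurrences. *)
Definition occurrence (a b : nat -> nat) (k : nat) (i : nat * bool) : Prop :=
  1 <= i.1 /\ (if i.2 then b i.1 else a i.1) = k.

(* Main.v *)
Require Import Defs.
From mathcomp Require Import all_boot.
From mathcomp Require Import zify.

(** Doubling changes the parity of the 2-adic valuation, so the pairs {k, 2k} with k of even valuation
    partition the positive integers. The P-positions are (0,0) and the (k, 2k),
    (2k, k) for these k.
    No move joins two of them: rows and columns contain at most one each, a
    diagonal move changes k but preserves the difference k of the coordinates,
    and a bounce from (k, 2k) stays in the row of k, whose only such position is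
    (2k, k), excluded by t < 2k.
    Conversely, let 0 < x < y. If x has odd valuation, move to (x, x/2); if it has
    even valuation and y > 2x, move to (x, 2x); if y < 2x, put d = y - x < x and
    move diagonally to (d, 2d) or bounce to (d/2, d), according to the parity of
    the valuation of d. *)

(** The conjunct [0 < n] matters because [logn 2 0] is 0 by convention, which would let 0 in. *)
Definition even_val (n : nat) : bool := (0 < n) && ~~ odd (logn 2 n).

Lemma even_val_gt0 n : even_val n -> 0 < n.
Proof. by case/andP. Qed.

Lemma even_val_double n : 0 < n -> even_val (2 * n) = ~~ even_val n.
Proof.
by move=> n_gt0; rewrite /even_val lognM // muln_gt0 n_gt0 (@lognE 2 2).
Qed.

Lemma odd_even_val n : odd n -> even_val n.
Proof.
by move=> odd_n; rewrite /even_val odd_gt0 // lognE dvdn2 odd_n !andbF.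
Qed.

Variant even_val_spec n : Prop :=
| EvenVal of even_val n
| DoubleEvenVal m of n = 2 * m & even_val m.

Lemma even_valP n : 0 < n -> even_val_spec n.
Proof.
move=> n_gt0; case: (boolP (even_val n)) => [|ev_n]; first exact: EvenVal.
have odd_n : ~~ odd n by apply: contra ev_n; exact: odd_even_val.
have def_n : n = 2 * n./2 by lia.
apply: (DoubleEvenVal _ _ def_n); apply/negPn.
by rewrite -even_val_double -?def_n //; lia.
Qed.

Lemma even_val_not_double m n : even_val m -> even_val n -> m <> 2 * n.
Proof.
by move=> ev_m ev_n mE; move: ev_m; rewrite mE even_val_double ?even_val_gt0 ?ev_n.
Qed.

Variant bee_cold : position -> Prop :=
| ColdOrigin : bee_cold (0, 0)
| ColdUp k of even_val k : bee_cold (k, 2 * k)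
| ColdDown k of even_val k : bee_cold (2 * k, k).

Lemma bee_coldP x y : bee_cold (x, y) ->
  [\/ x = 0 /\ y = 0, even_val x /\ y = 2 * x | even_val y /\ x = 2 * y].
Proof.
by move=> c; inversion c; subst; [apply: Or31 | apply: Or32 | apply: Or33].
Qed.

Lemma bee_cold_no_move p q : bee_move p q -> bee_cold p -> ~ bee_cold q.
Proof.
case=> [x y x' lt_x|x y y' lt_y|x y s le_s|x y t lt_xy lt_t|x y t lt_yx lt_t];
  move=> /bee_coldP[[? ?]|[ev_p ?]|[ev_p ?]] /bee_coldP[[? ?]|[ev_q ?]|[ev_q ?]];
  (* [try] covers the cases with the origin. In the others, linear arithmetic needs only positivity
     and that neither even-valuation parameter is double the other. *)
  try have p_gt0 := even_val_gt0 _ ev_p; try have q_gt0 := even_val_gt0 _ ev_q;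
  try have not_pq := even_val_not_double _ _ ev_p ev_q;
  try have not_qp := even_val_not_double _ _ ev_q ev_p; lia.
Qed.

Lemma bee_move_swap p q : bee_move p q -> bee_move (p.2, p.1) (q.2, q.1).
Proof.
case=> *; [exact: DownMove | exact: LeftMove | | exact: BounceDownMove
  | exact: BounceLeftMove].
by apply: DiagonalMove; rewrite minnC.
Qed.

Lemma bee_cold_swap p : bee_cold p -> bee_cold (p.2, p.1).
Proof. by case=> *; constructor. Qed.

Lemma bee_cold_or_move_le x y : x <= y ->
  bee_cold (x, y) \/ exists2 q, bee_move (x, y) q & bee_cold q.
Proof.
case: (posnP x) => [->|x_gt0 le_xy].
  case: y => [|y] _; [left | right]; first exact: ColdOrigin.
  by exists (0, 0); [exact: DownMove | exact: ColdOrigin].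
have [def_y|neq_xy] := eqVneq x y.
  right; exists (x - x, y - x); first by apply: DiagonalMove; lia.
  by rewrite -def_y subnn; exact: ColdOrigin.
case: (even_valP _ x_gt0) => [ev_x|k def_x ev_k]; last first.
  right; exists (x, k); first by apply: DownMove; lia.
  by rewrite def_x; exact: ColdDown.
case: (ltngtP y (2 * x)) => [lt_y|gt_y|->]; last by left; exact: ColdUp.
- have d_gt0 : 0 < y - x by lia.
  right; case: (even_valP _ d_gt0) => [ev_d|k def_d ev_k].
    (* A diagonal move preserves [y - x]; the length [2 * x - y] makes this difference the smaller
       coordinate. *)
    exists (x - (2 * x - y), y - (2 * x - y)); first by apply: DiagonalMove; lia.
    have -> : x - (2 * x - y) = y - x by lia.
    have -> : y - (2 * x - y) = 2 * (y - x) by lia.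
    exact: ColdUp.
  exists (k, y - x); last by rewrite def_d; exact: ColdUp.
  by have k_gt0 := even_val_gt0 _ ev_k; apply: BounceLeftMove; lia.
- by right; exists (x, 2 * x); [exact: DownMove | exact: ColdUp].
Qed.

Lemma bee_cold_or_move p :
  bee_cold p \/ exists2 q, bee_move p q & bee_cold q.
Proof.
case: p => x y; case/orP: (leq_total x y) => [|le_yx].
  exact: bee_cold_or_move_le.
case: (bee_cold_or_move_le _ _ le_yx) => [/bee_cold_swap|[q mq cq]]; first by left.
by right; exists (q.2, q.1); [exact: bee_move_swap mq | exact: bee_cold_swap].
Qed.

(** Cold positions form a kernel of the move graph: no move joins two of them, and every other
    position has a move into them. A well-founded graph has only one kernel. *)
Lemma P_position_cold p : P_position p <-> bee_cold p.
Proof.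
elim/(well_founded_ind option_of_wf): p => p IHp; rewrite P_positionE; split.
  move=> noP; case: (bee_cold_or_move p) => // -[q mq cq].
  by case: (noP q mq); apply/(IHp q mq).
by move=> cp q mq /(IHp q mq); exact: bee_cold_no_move mq cp.
Qed.

(** The mirror family [(2 * y, y)] is incompatible with [x <= y], since [y] is positive there. *)
Lemma P_position_le x y : x <= y ->
  (P_position (x, y) /\ (x, y) <> (0, 0)) <-> (even_val x /\ y = 2 * x).
Proof.
move=> le_xy; rewrite P_position_cold; split=> [[/bee_coldP c nz]|[ev_x ->]].
  case: c => [[x0 y0]|//|[/even_val_gt0 y_gt0 xE]]; last lia.
  by case: nz; rewrite x0 y0.
split; first exact: ColdUp.
by case=> x0; move: ev_x; rewrite x0.
Qed.

(* Of two consecutive integers one is odd, hence has even valuation. *)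
Definition next_even_val (m : nat) : nat :=
  if even_val m.+1 then m.+1 else m.+2.

Lemma next_even_valP m :
  [/\ m < next_even_val m, even_val (next_even_val m)
    & forall k, m < k < next_even_val m -> ~~ even_val k].
Proof.
rewrite /next_even_val; case: ifPn => [ev|nev]; split=> //; try by move=> k; lia.
- have : ~~ odd m.+1 by apply: contra nev; exact: odd_even_val.
  by move=> even_m1; apply: odd_even_val.
- by move=> k lt_k; have -> : k = m.+1 by lia.
Qed.

(** The sequence 1, 3, 4, 5, 7, 9, 11, 12, ... from index 1 on; the value 0 at index 0 is only a
    seed. *)
Definition nth_even_val (n : nat) : nat := iter n next_even_val 0.

Lemma nth_even_val_even n : 0 < n -> even_val (nth_even_val n).
Proof. by case: n => // n _; case: (next_even_valP (nth_even_val n)). Qed.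

Lemma nth_even_val_mono : {homo nth_even_val : m n / m < n}.
Proof.
apply: homo_ltn => [? ? ?|n]; first exact: ltn_trans.
by case: (next_even_valP (nth_even_val n)).
Qed.

(** Take the least [n] whose term is at least [k]; a strict inequality would put [k] in a gap
    between consecutive terms. *)
Lemma nth_even_val_onto k :
  even_val k -> exists2 n, 0 < n & nth_even_val n = k.
Proof.
move=> ev_k; have ge_id n : n <= nth_even_val n.
  elim: n => // n IHn; exact: leq_ltn_trans IHn (nth_even_val_mono _ _ (ltnSn n)).
have ex_n : exists n, k <= nth_even_val n by exists k.
case: (ex_minnP ex_n) => -[|n] le_k min_n.
  by have := even_val_gt0 _ ev_k; rewrite ltnNge le_k.
exists n.+1 => //; apply/eqP; rewrite eqn_leq le_k andbT leqNgt.
have [_ _ gap] := next_even_valP (nth_even_val n).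
apply/negP => lt_k; move: ev_k; apply/negP; apply: gap; rewrite lt_k andbT.
by rewrite ltnNge; apply/negP => /min_n; rewrite ltnn.
Qed.

Theorem theorem1 :
  (exists a b : nat -> nat, lists_P_positions a b) /\
  (forall a b : nat -> nat, lists_P_positions a b ->
     (forall n, 1 <= n -> b n = 2 * a n) /\
     (forall k, 0 < k -> exists! i : nat * bool, occurrence a b k i)).
Proof.
split.
  exists nth_even_val, (fun n => 2 * nth_even_val n); split=> [n n_gt0|x y Pxy nz le_xy|m n _].
  - have le_2 : nth_even_val n <= 2 * nth_even_val n by lia.
    have [|P nz] := (P_position_le _ _ le_2).2; last by [].
    by split; first exact: nth_even_val_even.
  - have [ev_x ->] := (P_position_le _ _ le_xy).1 (conj Pxy nz).
    by have [n n_gt0 <-] := nth_even_val_onto _ ev_x; exists n.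
  - exact: nth_even_val_mono.
move=> a b [Pab onto mono].
have abE n : 1 <= n -> even_val (a n) /\ b n = 2 * a n.
  by case/Pab => P nz le_ab; apply/(P_position_le _ _ le_ab).
have a_inj m n : 1 <= m -> 1 <= n -> a m = a n -> m = n.
  move=> m1 n1 eq_a; case: (ltngtP m n) => // lt_mn.
    by have := mono _ _ m1 lt_mn; rewrite eq_a ltnn.
  by have := mono _ _ n1 lt_mn; rewrite eq_a ltnn.
have a_onto k : even_val k -> exists2 n, 1 <= n & a n = k.
  move=> ev_k; have le_2 : k <= 2 * k by lia.
  have [P nz] := (P_position_le _ _ le_2).2 (conj ev_k erefl).
  by have [n n1 [an _]] := onto _ _ P nz le_2; exists n.
split=> [n /abE[] //|k k_gt0].
(* A number of even valuation can occur only among the [a n], any other only among the [b n];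
   injectivity of [a] then fixes the index. *)
case: (even_valP _ k_gt0) => [ev_k|m def_k ev_m].
  have [n n1 an] := a_onto k ev_k; exists (n, false); split=> // -[m []] [/= m1].
    have [ev_a ->] := abE m m1 => kE.
    by case: (even_val_not_double _ _ ev_k ev_a).
  by rewrite -an => /esym/a_inj ->.
have [n n1 an] := a_onto m ev_m; have [_ bn] := abE n n1.
exists (n, true); split=> [|[l []] [/= l1]]; first by split=> //=; rewrite bn an def_k.
  have [_ ->] := abE l l1 => eq_k; congr pair.
  by apply: a_inj => //; lia.
have [ev_a _] := abE l l1 => eq_k.
by case: (even_val_not_double _ _ ev_a ev_m); rewrite eq_k.
Qed.
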